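(* Let $T\ge 1$ and let $\{f_n\}_{n\ge1}$, $\{g_n\}_{n\ge1}$ be sequences of probability densities with $f_{n+T}=f_n$ and $g_{n+T}=g_n$ for all $n\ge1$. For a sequence of observations $\{X_n\}_{n\ge 1}$ define, for $n\ge 1$, $$W_{n} = \max_{1 \leq k \leq n} \sum_{i=k}^{n} \log \frac{g_{i}(X_{i})}{f_{i}(X_{i})}.$$ Then the sequence $\{W_n\}$ can be computed recursively as $$W_{n+1} = W_n^{+} + \log \frac{g_{n+1}(X_{n+1})}{f_{n+1}(X_{n+1})},\qquad n\ge 1,$$ where $(x)^+=\max\{x,0\}$. Further, since the sets of pre- and post-change densities $(f_1,\dots,f_T)$ and $(g_1,\dots,g_T)$ are finite, this recursion can be computed using the finite memory needed to store these $2T$ densities.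
   Context: A process $\{X_n\}$ is called independent and periodically identically distributed (i.p.i.d.) with law $(f_1,\dots,f_T)$ if the $X_n$ are independent, $X_n$ has density $f_n$, and $f_{n+T}=f_n$ for all $n\ge1$. In the change point model, the $X_n$ are independent with $X_n\sim f_n$ for $n<\nu$ and $X_n\sim g_n$ for $n\ge\nu$, where $\nu$ is the change point and $g_i\ne f_i$ for at least one $i\in\{1,\dots,T\}$. *)

(* Defs.v *)
From HB Require Import structures.
From mathcomp Require Import all_boot all_order all_algebra.
From mathcomp Require Import all_classical all_reals all_analysis.

Set Implicit Arguments.
Unset Strict Implicit.
Unset Printing Implicit Defensive.

Import Order.TTheory GRing.Theory Num.Theory.

Local Open Scope ring_scope.
Local Open Scope ereal_scope.

(* Densities are taken with respect to an arbitrary dominating measure. *)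
Definition prob_density (R : realType) (d : measure_display)
    (S : measurableType d) (mu : {measure set S -> \bar R}) (p : S -> R) :=
  [/\ measurable_fun setT p, (forall y, (0 <= p y)%R)
    & \int[mu]_y (p y)%:E = 1].

(* Sequences are indexed from 1; the value at index 0 is irrelevant. *)
Definition periodic_densities (R : realType) (d : measure_display)
    (S : measurableType d) (mu : {measure set S -> \bar R}) (T : nat)
    (f : nat -> S -> R) :=
  (forall n, (1 <= n)%N -> prob_density mu (f n)) /\
  (forall n, (1 <= n)%N -> f (n + T)%N = f n).

(* log (q y / p y), with values in the extended reals because a density may
   vanish at an observation: the ratio is computed in \bar R, where
   a / 0 = +oo for a > 0 and 0 / 0 = 0, so the logarithm is +oo if only p
   vanishes at y and -oo if q does. In \bar R, +oo + -oo = -oo. *)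
Definition log_ratio (R : realType) (S : Type) (p q : S -> R) (y : S) : \bar R :=
  lne ((q y)%:E / (p y)%:E).

Lemma log_ratio_pos (R : realType) (S : Type) (p q : S -> R) (y : S) :
  (0 < p y)%R -> (0 < q y)%R -> log_ratio p q y = (ln (q y / p y))%:E.
Proof.
move=> p0 q0; rewrite /log_ratio inver (gt_eqF p0) -EFinM lne_EFin//.
by rewrite divr_gt0.
Qed.

(* x is a realization of the observations X_1, X_2, ... *)
Definition W (R : realType) (S : Type) (f g : nat -> S -> R) (x : nat -> S)
    (n : nat) : \bar R :=
  \big[maxe/-oo]_(1 <= k < n.+1)
    \sum_(k <= i < n.+1) log_ratio (f i) (g i) (x i).

(* A program for the recursion whose only memory, besides the current value of
   the statistic, is two read-only tables of T densities and a control state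
   ranging over a finite type. The program sees neither the time index nor
   past observations: the control state alone determines the table entries
   that are read. *)
Record program (T : nat) := Program {
  control : finType;
  start : control;
  next_control : control -> control;
  pre_addr : control -> 'I_T;
  post_addr : control -> 'I_T }.

Definition step (R : realType) (S : Type) (T : nat) (M : program T)
    (pre post : 'I_T -> S -> R) (s : control M * \bar R) (y : S) :
    control M * \bar R :=
  (next_control s.1,
   maxe s.2 0 + log_ratio (pre (pre_addr s.1)) (post (post_addr s.1)) y).

(* State after the observations x 1, ..., x n; the statistic starts at 0. *)
Fixpoint run (R : realType) (S : Type) (T : nat) (M : program T)
    (pre post : 'I_T -> S -> R) (x : nat -> S) (n : nat) :
    control M * \bar R :=
  if n is m.+1 then step pre post (run M pre post x m) (x n)
  else (start M, 0).

(* Main.v *)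
Require Import Defs.
From mathcomp Require Import all_boot all_order all_algebra.
From mathcomp Require Import all_classical all_reals all_analysis.

Import Order.TTheory.

Local Open Scope ring_scope.
Local Open Scope ereal_scope.

(** Splitting off the newest log-likelihood ratio [L] from every sum in the
    maximum gives [W_{n+1} = max (max_{k <= n} (S_k + L)) L], where [S_k] is
    the sum from [k] to [n]; then [L] comes out of the maximum, leaving
    [max (W_n, 0) + L]. Taking [L] out is the point that needs care, because
    the log-likelihood ratios may be infinite: it is legitimate since
    [x |-> x + L] is nondecreasing on the extended reals for every [L],
    including [L = +oo] and [L = -oo], and since it fixes [-oo], the value of
    the empty maximum ([bigmaxe_addr]).

    The same identity holds at [n = 0], where [W_0 = -oo] is the empty maximum,
    and [max (-oo, 0) = max (0, 0)]; so a run of the recursion started at [0]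
    instead of [-oo] produces [W_n] from [n = 1] on. By periodicity, the
    densities used at time [n + 1] are those of index [(n mod T) + 1], hence
    a cyclic counter modulo [T] is enough to address the two tables. *)

(** The empty maximum [-oo] is absorbing for the addition, even of [+oo], so
    the identity holds for an empty range too. *)
Lemma bigmaxe_addr (R : realType) (I : Type) (r : seq I) (P : pred I)
    (F : I -> \bar R) (c : \bar R) :
  \big[maxe/-oo]_(i <- r | P i) F i + c
  = \big[maxe/-oo]_(i <- r | P i) (F i + c).
Proof.
apply: (big_morph (fun x => x + c)) => [a b|]; first exact: adde_maxl.
by rewrite addNye.
Qed.

Lemma W0 (R : realType) (S : Type) (f g : nat -> S -> R) (x : nat -> S) :
  W f g x 0 = -oo.
Proof. by rewrite /W big_geq. Qed.

Lemma W_recursion (R : realType) (S : Type) (f g : nat -> S -> R)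
    (x : nat -> S) (n : nat) :
  W f g x n.+1
  = maxe (W f g x n) 0 + log_ratio (f n.+1) (g n.+1) (x n.+1).
Proof.
rewrite /W big_nat_recr //= big_nat1 adde_maxl add0e bigmaxe_addr.
congr (Order.max _ _); apply: eq_big_nat => k /andP[_ k_lt_Sn].
by rewrite big_nat_recr //=; exact: ltnW.
Qed.

Lemma periodic_modn (A : Type) (T : nat) (f : nat -> A) :
  (forall n, (1 <= n)%N -> f (n + T)%N = f n) ->
  forall n, f (n %% T).+1 = f n.+1.
Proof.
move=> fT n; rewrite [in RHS](divn_eq n T).
elim: (n %/ T)%N => [|q IHq]; first by rewrite mul0n add0n.
by rewrite IHq -fT // mulSn [in LHS]addnC addnS addnA.
Qed.

(** The counter is the number of observations read so far, modulo [T]; the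
    table entry at address [i] belongs to the times congruent to [i + 1]. *)
Definition cyclic_program (T : nat) (hT : (1 <= T)%N) : program T :=
  {| control := 'I_T;
     start := Ordinal hT;
     next_control := @ordS T;
     pre_addr := id;
     post_addr := id |}.

Lemma cyclic_program_control (R : realType) (S : Type) (T : nat)
    (hT : (1 <= T)%N) (pre post : 'I_T -> S -> R) (x : nat -> S) (n : nat) :
  (run (cyclic_program T hT) pre post x n).1 = (n %% T)%N :> nat.
Proof.
elim: n => [|n IHn] /=; first by rewrite mod0n.
by rewrite IHn -addn1 modnDml addn1.
Qed.

(** The initial values [W_0 = -oo] and [0] of the statistic differ, hence the
    shift; they have the same positive part, which is all that the first step
    reads. *)
Lemma cyclic_program_computes_W (R : realType) (S : Type) (T : nat)
    (hT : (1 <= T)%N) (f g : nat -> S -> R)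
    (fT : forall n, (1 <= n)%N -> f (n + T)%N = f n)
    (gT : forall n, (1 <= n)%N -> g (n + T)%N = g n)
    (x : nat -> S) (n : nat) :
  W f g x n.+1
  = (run (cyclic_program T hT) (fun i => f i.+1) (fun i => g i.+1) x n.+1).2.
Proof.
set st := run _ _ _ _.
have st_recursion m : (st m.+1).2
    = maxe (st m).2 0 + log_ratio (f m.+1) (g m.+1) (x m.+1).
  by rewrite /st /= cyclic_program_control !periodic_modn.
elim: n => [|n IHn]; rewrite W_recursion st_recursion; last by rewrite IHn.
by rewrite W0 maxNye maxxx.
Qed.

Theorem lemma1 (R : realType) (d : measure_display) (S : measurableType d)
    (mu : {measure set S -> \bar R}) (T : nat) (hT : (1 <= T)%N) :
  (forall f g : nat -> S -> R,
     periodic_densities mu T f -> periodic_densities mu T g ->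
     forall (x : nat -> S) (n : nat), (1 <= n)%N ->
       W f g x n.+1
       = maxe (W f g x n) 0 + log_ratio (f n.+1) (g n.+1) (x n.+1)) /\
  (exists M : program T, forall f g : nat -> S -> R,
     periodic_densities mu T f -> periodic_densities mu T g ->
     forall (x : nat -> S) (n : nat), (1 <= n)%N ->
       W f g x n
       = (run M (fun i : 'I_T => f i.+1) (fun i : 'I_T => g i.+1) x n).2).
Proof.
split=> [f g _ _ x n _|]; first exact: W_recursion.
exists (cyclic_program T hT) => f g [_ fT] [_ gT] x [//|n] _.
exact: cyclic_program_computes_W.
Qed.
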